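(* Let $m\in\mathbb{N}$ and let $a_1,\dotsc,a_m$ be nonnegative integers. Let $b_n$ denote the Bernoulli numbers of the second kind. Then $$\bigl|(a_k+a_j)!\,b_{a_k+a_j+1}\bigr|_m\ge0$$ and $$\bigl|(-1)^{a_k+a_j}(a_k+a_j)!\,b_{a_k+a_j+1}\bigr|_m\ge0,$$ where $|a_{kj}|_m$ denotes the determinant of order $m$ with elements $a_{kj}$, $1\le k,j\le m$.
   Context: The Bernoulli numbers of the second kind $b_n$, $n\ge 0$, are the real numbers defined by the power series expansion (around $x=0$) $\frac{x}{\ln(1+x)}=\sum_{n=0}^\infty b_nx^n$, where the left-hand side is given its limit value $1$ at $x=0$. Here $\mathbb{N}=\{1,2,3,\dotsc\}$. *)

(* Defs.v *)
From mathcomp Require Import all_boot all_order all_algebra.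
From mathcomp Require Import all_classical all_reals all_analysis.
Set Implicit Arguments.
Unset Strict Implicit.
Unset Printing Implicit Defensive.
Import Order.TTheory GRing.Theory Num.Theory.
Import numFieldNormedType.Exports.
Local Open Scope classical_set_scope.
Local Open Scope ring_scope.

(* The case distinction is needed because [0 / ln (1 + 0)] is [0] in MathComp,
   not the limit value [1]. *)
Definition bernoulli2_gen (R : realType) (x : R) : R :=
  if x == 0 then 1 else x / ln (1 + x).

(* This property determines [b] uniquely, by uniqueness of power series
   expansions around 0. *)
Definition is_bernoulli2 (R : realType) (b : nat -> R) : Prop :=
  \forall x \near (0 : R), pseries b x @ \oo --> bernoulli2_gen x.

(* Main.v *)
Require Import Defs.
From HB Require Import structures.
From mathcomp Require Import all_boot all_order all_algebra.
From mathcomp Require Import all_classical all_reals all_analysis.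
From mathcomp Require Import polyrcf ring lra.
Set Implicit Arguments.
Unset Strict Implicit.
Unset Printing Implicit Defensive.
Import Order.TTheory GRing.Theory Num.Theory.
Import numFieldNormedType.Exports.
Local Open Scope ring_scope.

(* Comparing Taylor coefficients in [1 = (x / ln (1 + x)) (ln (1 + x) / x)]
   gives a recurrence that determines [b n]; it is also satisfied by the
   integrals over [0 <= t <= 1] of the polynomials [t (t - 1) ... (t - n + 1) / n!],
   since [d/dt (1 + x)^t = ln (1 + x) (1 + x)^t].  Writing
   [(s)_n = s (s + 1) ... (s + n - 1)], it follows that
     [(-1)^n n! b (n + 1) = int_0^1 int_0^1 t (1 - t)_n u^n du dt].
   The Hankel matrix of the sequence [(s)_n] is positive semidefinite for
   [s >= 0], because Vandermonde's identity gives
     [(s)_(i+j) = sum_l l! (s)_l 'C(i,l) (s+l)_(i-l) 'C(j,l) (s+l)_(j-l)];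
   hence so is the Hankel matrix of [(-1)^n n! b (n + 1)], and the sign is
   absorbed by the change of variables [x_k -> (-1)^(a_k) x_k].  All integrands
   are polynomials, so only formal primitives are needed. *)

(** * Determinants of positive semidefinite forms *)

(* A real eigenvalue of [M] is nonnegative, so the characteristic polynomial
   of [- M] has no positive root and, being monic, is nonnegative at [0]. *)
Lemma det_ge0_quadform (R : rcfType) (m : nat) (M : 'M[R]_m) :
  (forall x : 'I_m -> R, 0 <= \sum_k \sum_j x k * x j * M k j) ->
  0 <= \det M.
Proof.
move=> Mpsd; set p := char_poly (- M).
have p0 : p.[0] = \det M.
  rewrite -horner_evalE -det_map_mx; congr (\det _); apply/matrixP => i j.
  by rewrite !mxE /= horner_evalE !hornerE hornerMn hornerX mul0rn add0r opprK.
rewrite -p0 leNgt; apply/negP => p0_lt0.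
have lp : 0 < lead_coef p by rewrite (eqP (char_poly_monic _)) ltr01.
have [B pB] := poly_pinfty_gt_lc lp.
have C0 : 0 <= Num.max B 0 by rewrite le_max lexx orbT.
have [|t /andP[t_ge0 _]] := @poly_ivt _ p 0 (Num.max B 0) C0.
  by rewrite ltW //= ltW // (lt_le_trans lp) // pB // le_max lexx.
rewrite -eigenvalue_root_char => /eigenvalueP[v vM v0].
have t_gt0 : 0 < t.
  rewrite lt_neqAle t_ge0 andbT; apply/negP => /eqP t0.
  move: p0_lt0; have /rootP := (etrans (esym (eigenvalue_root_char (- M) t))
     (introT eigenvalueP (ex_intro2 _ _ v vM v0))).
  by rewrite -t0 => ->; rewrite ltxx.
have vMj j : \sum_k v 0 k * M k j = - t * v 0 j.
  have := congr1 (fun w : 'rV_m => - w 0 j) vM.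
  rewrite !mxE mulNr => <-; rewrite -sumrN; apply: eq_bigr => k _.
  by rewrite mxE mulrN opprK.
have := Mpsd (v 0).
rewrite exchange_big /=.
rewrite (eq_bigr (fun j => - t * v 0 j ^+ 2)); last first.
  move=> j _; rewrite expr2 mulrA -vMj mulr_suml; apply: eq_bigr => k _.
  by rewrite mulrAC.
rewrite -mulr_sumr mulNr oppr_ge0 pmulr_rle0 // => vv.
have [j vj] : exists j, v 0 j != 0.
  by apply/rV0Pn.
have : 0 < \sum_j v 0 j ^+ 2.
  rewrite (bigD1 j) //= ltr_pwDl ?exprn_even_gt0 //.
  by apply: sumr_ge0 => k _; apply: sqr_ge0.
by rewrite ltNge vv.
Qed.

(** * Rising factorials and their Hankel forms *)

Section RisingFactorial.
Variable A : comNzRingType.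
Implicit Type s : A.

Definition rising s n : A := \prod_(i < n) (s + i%:R).

Lemma rising0 s : rising s 0 = 1.
Proof. by rewrite /rising big_ord0. Qed.

Lemma risingSr s n : rising s n.+1 = rising s n * (s + n%:R).
Proof. by rewrite /rising big_ord_recr. Qed.

Lemma risingD s m n : rising s (m + n) = rising s m * rising (s + m%:R) n.
Proof.
elim: n => [|n IHn]; first by rewrite addn0 rising0 mulr1.
by rewrite addnS !risingSr IHn natrD addrA mulrA.
Qed.

Lemma risingS s n : rising s n.+1 = s * rising (s + 1) n.
Proof. by rewrite -add1n risingD /rising big_ord1 addr0. Qed.

(** Induction on [i] for all [s] and [j]: raising [i] by one adds
    [j.+1%:R * rising (s + 1 + i%:R) j] to the value at [j.+1], and the coefficients then match by
    Pascal's rule for falling factorials in [i]. *)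
Lemma rising_Vandermonde s i j :
  rising (s + i%:R) j =
    \sum_(l < j.+1) ('C(j, l) * i ^_ l)%:R * rising (s + l%:R) (j - l).
Proof.
elim: i s j => [|i IHi] s [|j].
- by rewrite big_ord1 !rising0 mulr1.
- rewrite big_ord_recl big1 => [|l _]; first by rewrite !addr0 bin0 ffactn0 muln1 mul1r subn0.
  by rewrite ffact0n muln0 mul0r.
- by rewrite big_ord1 !rising0 mulr1.
have -> : rising (s + i.+1%:R) j.+1 =
    rising (s + i%:R) j.+1 + j.+1%:R * rising (s + 1 + i%:R) j.
  rewrite risingSr risingS -natr1 addrA -natr1.
  have -> : s + 1 + i%:R = s + i%:R + 1 by rewrite addrAC.
  by ring.
rewrite !IHi big_ord_recl [RHS]big_ord_recl !bin0 !ffactn0 -addrA.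
congr (_ + _); rewrite mulr_sumr -big_split; apply: eq_bigr => l _ /=.
rewrite /bump /= add1n subSS -(addrA s 1) -mulrS mulrA -natrM -mulrDl -natrD.
congr (_%:R * _).
rewrite mulnA mul_bin_diag ffactSS ffactnSr.
have [li|/ffact_small->] := leqP l i; last by rewrite !muln0.
have -> : i.+1 = (i - l + l.+1)%N by rewrite addnS subnK.
by ring.
Qed.

(** A factorization L D L^T with D diagonal. The range [N] can be shared by all entries of a Hankel
    matrix, because the binomials vanish once [l] exceeds [i] or [j]. *)
Lemma rising_diagonalization s N i j : (j < N)%N ->
  rising s (i + j) =
    \sum_(l < N) (l`!)%:R * rising s l *
      (('C(i, l))%:R * rising (s + l%:R) (i - l)) *
      (('C(j, l))%:R * rising (s + l%:R) (j - l)).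
Proof.
move=> jN; rewrite risingD rising_Vandermonde mulr_sumr (big_ord_widen _
  (fun l => rising s i * (('C(j, l) * i ^_ l)%:R * rising (s + l%:R) (j - l))) jN).
rewrite big_mkcond /=; apply: eq_bigr => l _; rewrite ltnS.
case: leqP => [lj|jl]; last by rewrite (bin_small jl) !(mul0r, mulr0).
have [li|il] := leqP l i; last first.
  by rewrite (ffact_small il) (bin_small il) !(mul0r, mulr0, muln0).
rewrite -{1}(subnKC li) risingD -bin_ffact !natrM.
by ring.
Qed.

End RisingFactorial.

Lemma rising_ge0 (R : realFieldType) (s : R) n : 0 <= s -> 0 <= rising s n.
Proof. by move=> s0; apply: prodr_ge0 => i _; rewrite addr_ge0. Qed.

Lemma rising_hankel_psd (R : realFieldType) (s : R) m (a : 'I_m -> nat)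
    (x : 'I_m -> R) : 0 <= s ->
  0 <= \sum_k \sum_j x k * x j * rising s (a k + a j).
Proof.
move=> s0; pose N := (\max_k a k).+1.
have aN k : (a k < N)%N by rewrite ltnS (leq_bigmax k).
pose g l k := x k * (('C(a k, l))%:R * rising (s + l%:R) (a k - l)).
have -> : \sum_k \sum_j x k * x j * rising s (a k + a j) =
    \sum_(l < N) (l`!)%:R * rising s l * (\sum_k g l k) ^+ 2.
  transitivity (\sum_k \sum_j \sum_(l < N)
      (l`!)%:R * rising s l * (g l k * g l j)).
    apply: eq_bigr => k _; apply: eq_bigr => j _.
    rewrite (rising_diagonalization _ _ (aN j)) mulr_sumr.
    by apply: eq_bigr => l _; rewrite /g; ring.
  under eq_bigr do rewrite exchange_big /=.
  rewrite exchange_big /=; apply: eq_bigr => l _.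
  rewrite expr2 big_distrlr mulr_sumr; apply: eq_bigr => k _ /=.
  by rewrite mulr_sumr.
apply: sumr_ge0 => l _.
by rewrite mulr_ge0 ?sqr_ge0 // mulr_ge0 ?ler0n // rising_ge0.
Qed.

(** * Formal integration of polynomials over the unit interval *)

Section PolynomialIntegral.
Variable R : rcfType.
Implicit Types p q : {poly R}.

(* The constant coefficient is [p`_0 / 0 = 0]. *)
Definition primitive p : {poly R} :=
  \poly_(i < (size p).+1) (p`_i.-1 / i%:R).

Lemma coef_primitive p i : (primitive p)`_i = p`_i.-1 / i%:R.
Proof.
rewrite coef_poly; case: i => [|i]; first by rewrite invr0 mulr0.
by rewrite ltnS; case: ltnP => // pi; rewrite nth_default // mul0r.
Qed.

Lemma deriv_primitive p : (primitive p)^`() = p.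
Proof.
apply/polyP => i; rewrite coef_deriv coef_primitive /= -[LHS]mulr_natr.
by rewrite divfK ?pnatr_eq0.
Qed.

Definition integ01 p : R := (primitive p).[1].

Lemma integ01_is_linear : scalar integ01.
Proof.
move=> c p q; rewrite /integ01 -hornerZ -hornerD; congr (_.[1]).
apply/polyP => i; rewrite coefD coefZ !coef_primitive coefD coefZ.
by rewrite mulrDl mulrA.
Qed.

HB.instance Definition _ :=
  GRing.isLinear.Build R {poly R} R *%R integ01 integ01_is_linear.

Lemma integ01_deriv p : integ01 p^`() = p.[1] - p.[0].
Proof.
rewrite /integ01 -[in RHS](hornerC p.[0] 1) -hornerN -hornerD; congr (_.[1]).
apply/polyP => i; rewrite coef_primitive coefB coefC horner_coef0.
case: i => [|i] /=; first by rewrite invr0 mulr0 subrr.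
by rewrite coef_deriv -[X in X / _]mulr_natr mulfK ?pnatr_eq0 // subr0.
Qed.

Lemma integ01Xn n : integ01 ('X^n : {poly R}) = n.+1%:R^-1.
Proof.
have -> : 'X^n = (n.+1%:R^-1 *: 'X^(n.+1))^`() :> {poly R}.
  by rewrite derivZ derivXn /= -[X in _ *: X]scaler_nat scalerA mulVf ?pnatr_eq0 ?scale1r.
by rewrite integ01_deriv !hornerZ !hornerXn expr1n expr0n mulr1 mulr0 subr0.
Qed.

(** By the mean value theorem for the primitive, the integral is a value of [p] inside the
    interval. *)
Lemma integ01_ge0 p :
  (forall x, 0 <= x <= 1 -> 0 <= p.[x]) -> 0 <= integ01 p.
Proof.
move=> p0; have [x] := poly_mvt (primitive p) (@ltr01 R).
rewrite deriv_primitive subr0 mulr1 => /itvP xI.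
have -> : (primitive p).[0] = 0.
  by rewrite horner_coef0 coef_primitive invr0 mulr0.
by rewrite subr0 /integ01 => ->; apply: p0; rewrite !ltW ?xI.
Qed.

End PolynomialIntegral.

Lemma horner_rising (R : comNzRingType) (p : {poly R}) n x :
  (rising p n).[x] = rising p.[x] n.
Proof.
rewrite horner_prod; apply: eq_bigr => i _.
by rewrite hornerD -polyC_natr hornerC.
Qed.

(** The denominator is the integral of [u ^+ (a k + a j)]. For fixed [t] and [u] the integrand is
    [t] times the Hankel form of [rising (1 - t)] at the vector [x k * u ^+ a k]. *)
Lemma integ01_rising_hankel_psd (R : rcfType) m (a : 'I_m -> nat)
    (x : 'I_m -> R) :
  0 <= \sum_k \sum_j x k * x j *
    (integ01 ('X * rising (1 - 'X) (a k + a j)) / (a k + a j).+1%:R).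
Proof.
pose c k j : R := x k * x j / (a k + a j).+1%:R.
have -> : \sum_k \sum_j x k * x j *
    (integ01 ('X * rising (1 - 'X) (a k + a j)) / (a k + a j).+1%:R) =
  integ01 (\sum_k \sum_j c k j *: ('X * rising (1 - 'X) (a k + a j))).
  rewrite linear_sum; apply: eq_bigr => k _.
  rewrite linear_sum; apply: eq_bigr => j _.
  by rewrite linearZ /= /c mulrA mulrAC.
apply: integ01_ge0 => t /andP[t0 t1].
have -> : (\sum_k \sum_j c k j *: ('X * rising (1 - 'X) (a k + a j))).[t] =
    t * integ01 (\sum_k \sum_j (x k * x j * rising (1 - t) (a k + a j)) *:
      'X^(a k + a j)).
  rewrite horner_sum linear_sum mulr_sumr; apply: eq_bigr => k _.
  rewrite horner_sum linear_sum mulr_sumr; apply: eq_bigr => j _.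
  rewrite linearZ /= integ01Xn hornerZ hornerM horner_rising.
  rewrite !(hornerD, hornerN, hornerX, hornerC) /c.
  by ring.
apply: mulr_ge0 => //; apply: integ01_ge0 => u _.
have s0 : 0 <= 1 - t by rewrite subr_ge0.
have := rising_hankel_psd a (fun k => x k * u ^+ a k) s0.
rewrite horner_sum; congr (0 <= _); apply: eq_bigr => k _.
rewrite horner_sum; apply: eq_bigr => j _.
by rewrite hornerZ hornerXn exprD; ring.
Qed.

(** * Binomial polynomials and the Gregory coefficients *)

Section BinomialPolynomial.
Variable R : rcfType.

Definition binpoly n : {poly R} :=
  (n`!)%:R^-1 *: \prod_(i < n) ('X - i%:R).

Lemma binpoly0 : binpoly 0 = 1.
Proof. by rewrite /binpoly big_ord0 invr1 scale1r. Qed.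

Lemma binpolyS n : n.+1%:R *: binpoly n.+1 = binpoly n * ('X - n%:R).
Proof.
rewrite /binpoly big_ord_recr /= factS natrM invfM scalerA mulrA.
by rewrite mulfV ?pnatr_eq0 // mul1r scalerAl.
Qed.

(* Coefficientwise form of [d/dt (1 + x)^t = ln (1 + x) (1 + x)^t]. *)
Lemma deriv_binpoly n : (binpoly n.+1)^`() =
  \sum_(k < n.+1) ((-1) ^+ k / k.+1%:R) *: binpoly (n - k).
Proof.
have n0 k : k.+1%:R != 0 :> R by rewrite pnatr_eq0.
elim: n => [|n IHn].
  rewrite big_ord1 binpoly0 expr0 divr1 scale1r.
  have := binpolyS 0; rewrite scale1r => ->.
  by rewrite binpoly0 mul1r subr0 derivX.
apply: (scalerI (n0 n.+1)).
have -> : n.+2%:R *: (binpoly n.+2)^`() =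
    (binpoly n.+1)^`() * ('X - n.+1%:R) + binpoly n.+1.
  rewrite -derivZ binpolyS derivM; congr (_ + _).
  by rewrite -polyC_natr derivXsubC mulr1.
(* The two terms left outside the sums, [binpoly n.+1] and the last summand on the right, become a
   telescoping sum, so that the identity can be checked for each [k] separately. *)
have tele : \sum_(k < n.+1)
      (-1) ^+ k *: (binpoly (n.+1 - k) + binpoly (n - k)) =
    (-1) ^+ n *: binpoly 0 + binpoly n.+1.
  pose f k : {poly R} := - ((-1) ^+ k *: binpoly (n.+1 - k)).
  have := telescope_sumr f (leq0n n.+1).
  rewrite big_mkord /f subnn expr0 scale1r subn0 exprS mulN1r scaleNr !opprK.
  move=> <-; apply: eq_bigr => k _.
  by rewrite subSS exprS mulN1r scaleNr !opprK scalerDr addrC.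
rewrite IHn [in RHS]big_ord_recr /= subnn scalerDr scaler_sumr mulr_suml.
rewrite scalerA (mulrC n.+2%:R) divfK // exprS mulN1r scaleNr.
apply/eqP; rewrite -subr_eq0 opprD opprK addrACA -sumrB (addrC (binpoly _)) -tele.
rewrite -big_split big1 //= => k _; rewrite -scalerAl.
have kn : (k <= n)%N by rewrite -ltnS.
(* Write ['X - n.+1%:R] as [('X - (n - k)%:R) - k.+1%:R]; [binpolyS] absorbs the first part. *)
have -> : binpoly (n - k) * ('X - n.+1%:R) =
    (n.+1 - k)%:R *: binpoly (n.+1 - k) - k.+1%:R *: binpoly (n - k).
  rewrite subSn // binpolyS -[in n.+1%:R](subnKC kn) -addSn natrD.
  by rewrite scaler_nat -[binpoly _ *+ _]mulr_natr -mulrBr; congr (_ * _); ring.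
move: (binpoly _) (binpoly _) => p q.
rewrite scalerBr !scalerA divfK // scalerDr [_ *: _ - _ - _]addrAC -scalerBl.
rewrite addrACA addNr addr0 -scalerDl.
have -> : n.+2%:R = (n.+1 - k)%:R + k.+1%:R :> R.
  by rewrite -natrD addnS subnK // leqW.
rewrite mulrDl [X in _ - (_ + X)]mulrC divfK //.
by apply/eqP; rewrite scaler_eq0; apply/orP; left; apply/eqP; ring.
Qed.

Lemma horner_binpoly n x :
  (binpoly n).[x] = (n`!)%:R^-1 * \prod_(i < n) (x - i%:R).
Proof.
rewrite hornerZ horner_prod; congr (_ * _); apply: eq_bigr => i _.
by rewrite -polyC_natr hornerXsubC.
Qed.

Definition gregory n : R := integ01 (binpoly n).

(** Integrating [deriv_binpoly] gives the difference of the values of [binpoly n.+1] at 1 and 0,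
    which is zero unless [n] is 0. *)
Lemma gregory_recurrence n :
  \sum_(k < n.+1) (-1) ^+ k / k.+1%:R * gregory (n - k) = (n == 0)%:R.
Proof.
have := integ01_deriv (binpoly n.+1); rewrite deriv_binpoly linear_sum /=.
under eq_bigr do rewrite linearZ /=.
move=> ->; rewrite !horner_binpoly.
rewrite [X in _ - _ * X]big_ord_recl subrr mul0r mulr0 subr0.
case: n => [|n]; first by rewrite big_ord1 subr0 invr1 mul1r.
by rewrite 2!big_ord_recl subrr mul0r !mulr0.
Qed.

(** The system is triangular, and the coefficient of [b n] is 1. *)
Lemma log_recurrence_unique (b c : nat -> R) :
  (forall n, \sum_(k < n.+1) (-1) ^+ k / k.+1%:R * b (n - k)%N =
     \sum_(k < n.+1) (-1) ^+ k / k.+1%:R * c (n - k)%N) -> b =1 c.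
Proof.
move=> bc n; elim/ltn_ind: n => n IHn; have := bc n.
rewrite !big_ord_recl /= expr0 divr1 !mul1r !subn0.
rewrite (eq_bigr (fun i : 'I_n => (-1) ^+ (bump 0 i) / (bump 0 i).+1%:R *
  c (n - bump 0 i)%N)); first by move/addIr.
move=> i _; rewrite IHn // /bump /= add1n ltn_subrL //=.
by case: n i {bc IHn} => [[]|].
Qed.

(** Each factor ['X - i.+1%:R] is the negative of [1 - 'X + i%:R]; the factor with index 0 gives the
    ['X] in front. *)
Lemma gregory_integral n : (-1) ^+ n * (n`!)%:R * gregory n.+1 =
  integ01 ('X * rising (1 - 'X) n) / n.+1%:R.
Proof.
rewrite /gregory /binpoly linearZ /= factS natrM.
have -> : \prod_(i < n.+1) ('X - i%:R) =
    (-1) ^+ n *: ('X * rising (1 - 'X) n) :> {poly R}.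
  rewrite big_ord_recl subr0 scalerAr; congr (_ * _).
  rewrite -mul_polyC polyC_exp polyCN -[n in _ ^+ n]card_ord -prodrN.
  by apply: eq_bigr => i _; rewrite /= /bump /= add1n -natr1; ring.
rewrite linearZ /= -[RHS]mul1r -[X in X * (_ / _)](sqrr_sign R n).
by field; rewrite -mulrS !pnatr_eq0 -!lt0n fact_gt0.
Qed.

End BinomialPolynomial.

(** * From the analytic definition to the recurrence *)

Lemma eq0_norm_le_linear (R : realFieldType) (a K d : R) : 0 < d ->
  (forall x, 0 < x <= d -> `|a| <= K * x) -> a = 0.
Proof.
move=> d0 aK; apply/eqP; apply/negPn/negP => a0.
have na : 0 < `|a| by rewrite normr_gt0.
have K0 : 0 < `|K| + 1 by rewrite ltr_wpDl.
(* This makes [K * x] at most half of the norm of [a]; adding 1 keeps the denominator positive when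
   [K] is 0. *)
pose x := Num.min d (`|a| / (2 * (`|K| + 1))).
have x0 : 0 < x by rewrite lt_min d0 divr_gt0 // mulr_gt0.
have := aK x; rewrite x0 ge_min lexx => /(_ isT) aKx.
have xK : x * (2 * (`|K| + 1)) <= `|a|.
  by rewrite -ler_pdivlMr ?mulr_gt0 // ge_min lexx orbT.
have : K * x <= `|K| * x by rewrite ler_wpM2r ?ler_norm // ltW.
nra.
Qed.

(** The bound forces the constant coefficient to be 0; dividing by [x] lowers [N] by one. Positive
    [x] suffice, so [ln (1 + x)] is only ever studied to the right of 0. *)
Lemma coef_eq0_horner_le (R : realFieldType) N (p : {poly R}) (C d : R) :
  0 < d -> (forall x, 0 < x <= d -> `|p.[x]| <= C * x ^+ N) ->
  forall i, (i < N)%N -> p`_i = 0.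
Proof.
move=> d0; elim: N p => // N IHN p; elim/poly_ind: p => [|p c _] pC i iN.
  by rewrite coef0.
have [D pD] := poly_disk_bound p d.
have c0 : c = 0.
  apply: (@eq0_norm_le_linear _ _ (`|C| * d ^+ N + D) d) => // x /andP[x0 xd].
  have := pC x; rewrite x0 xd hornerMXaddC => /(_ isT) px.
  have xx : `|x| = x by rewrite gtr0_norm.
  have Dx : `|p.[x] * x| <= D * x.
    by rewrite normrM xx ler_wpM2r ?pD ?xx // ltW.
  have Cx : C * x ^+ N.+1 <= `|C| * d ^+ N * x.
    rewrite exprSr mulrA ler_wpM2r ?(ltW x0) //.
    apply: le_trans (_ : `|C| * x ^+ N <= _).
      by rewrite ler_wpM2r ?ler_norm // exprn_ge0 // ltW.
    by rewrite ler_wpM2l // lerXn2r // nnegrE ltW.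
  have := ler_normB (p.[x] * x + c) (p.[x] * x).
  by rewrite addrAC subrr add0r mulrDl; lra.
rewrite c0 addr0 coefMX; case: i iN => //= i iN.
apply: (IHN p) => // x /andP[x0 xd].
have := pC x; rewrite x0 xd c0 hornerMXaddC addr0 => /(_ isT).
by rewrite normrM (gtr0_norm x0) exprSr mulrA ler_pM2r.
Qed.

(** By a finite geometric sum the remainder has derivative [(- t) ^+ N / (1 + t)], of norm at most
    [x ^+ N] for [t] between 0 and [x]; the mean value theorem supplies one more factor [x]. *)
Lemma ln1D_taylor (R : realType) (x : R) N : 0 < x ->
  `|ln (1 + x) - x * (\poly_(k < N) ((-1) ^+ k / k.+1%:R)).[x]| <= x ^+ N.+1.
Proof.
move=> x0; set L := \poly_(k < N) _.
pose f (t : R) := ln (1 + t) - ('X * L).[t].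
pose df (t : R) := (1 + t)^-1 - ('X * L)^`().[t].
have fd (t : R) : 0 <= t -> is_derive t 1 f (df t).
  move=> t0; have t1 : 0 < 1 + t by rewrite ltr_pwDl.
  have dg : is_derive t (1 : R) (fun u : R => 1 + u) 1.
    apply: (is_derive_eq (is_deriveD (is_derive_cst (1 : R) t 1)
      (is_derive_id t 1))).
    by rewrite add0r.
  have dl := is_derive1_comp (is_derive1_ln t1) dg.
  apply: (is_derive_eq (is_deriveB dl (is_derive_poly ('X * L) t))).
  by rewrite mulr1.
have dfE (t : R) : 0 <= t -> df t = (- t) ^+ N / (1 + t).
  move=> t0; have t1 : 1 + t != 0 by rewrite gt_eqF // ltr_pwDl.
  have -> : df t = (1 + t)^-1 - \sum_(k < N) (- t) ^+ k.
    rewrite /df; congr (_ - _).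
    have -> : ('X * L)^`() = \poly_(k < N) (-1) ^+ k.
      apply/polyP => i; rewrite coef_deriv coefXM /= !coef_poly.
      case: ifP => _; last by rewrite mul0rn.
      by rewrite -[LHS]mulr_natr divfK // pnatr_eq0.
    by rewrite horner_poly; apply: eq_bigr => k _; rewrite -exprMn mulN1r.
  have := subrX1 (- t) N; move: (\sum_(k < N) _) => S.
  by move/eqP; rewrite subr_eq => /eqP ->; field.
have fc : {within `[0, x], continuous f}%classic.
  apply: derivable_within_continuous => t; rewrite in_itv /= => /andP[t0 _].
  by have [] := fd t t0.
have [|t] := @MVT_segment _ f df _ _ (ltW x0) _ fc.
  by move=> t; rewrite in_itv /= => /andP[t0 _]; apply/fd/ltW.
rewrite in_itv /= => /andP[t0 tx].
rewrite {1 2}/f !hornerM !hornerX mul0r addr0 ln1 !subr0 => ->.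
rewrite dfE // normrM (gtr0_norm x0) exprSr ler_wpM2r ?(ltW x0) //.
rewrite normrM normrX normrN (ger0_norm t0).
rewrite normfV (@gtr0_norm _ (1 + t)) ?ltr_pwDl // ler_pdivrMr ?ltr_pwDl //.
apply: le_trans (_ : x ^+ N <= _); first by rewrite lerXn2r // nnegrE // ltW.
by rewrite ler_peMr ?exprn_ge0 ?(ltW x0) // lerDl.
Qed.

Lemma pseries_tail_le (R : realType) (b : nat -> R) (r : R) N :
  0 < r -> cvgn (pseries b r) ->
  exists C, forall x l, 0 < x <= r / 2 -> (pseries b x @ \oo --> l)%classic ->
    `|l - (\poly_(i < N) b i).[x]| <= C * x ^+ N.
Proof.
move=> r0 /cvg_series_bounded /pinfty_ex_gt0 [M M0 bM].
(* [M] bounds all terms at [r], so the tail at [x] is dominated by a geometric series of ratio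
   [x / r], at most one half; hence the 2. *)
exists (2 * M / r ^+ N) => x l /andP[x0 xr] xl.
set B := (\poly_(i < N) b i).[x].
have BE : B = \sum_(0 <= i < N) b i * x ^+ i.
  by rewrite /B horner_poly big_mkord.
have q0 : 0 <= x / r by rewrite divr_ge0 // ltW.
have q2 : x / r <= 1 / 2 by rewrite ler_pdivrMr // mulrC mulrA mulr1.
have bx i : `|b i * x ^+ i| <= M * (x / r) ^+ i.
  have := bM i I; rewrite /= !normrM !normrX (gtr0_norm r0) (gtr0_norm x0).
  rewrite expr_div_n => h.
  have -> : M * (x ^+ i / r ^+ i) = M / r ^+ i * x ^+ i by rewrite mulrA mulrAC.
  by rewrite ler_wpM2r ?exprn_ge0 ?(ltW x0) // ler_pdivlMr ?exprn_gt0.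
have geo K : \sum_(0 <= i < K) (x / r) ^+ i <= 2.
  elim: K => [|K IHK]; first by rewrite big_geq.
  rewrite big_nat_recl // expr0.
  under eq_bigr do rewrite exprS.
  by rewrite -mulr_sumr; nra.
have tail K : `|pseries b x (N + K)%N - B| <= 2 * M / r ^+ N * x ^+ N.
  rewrite /pseries /series /= BE (big_cat_nat (n := N)) ?leq_addr //=.
  rewrite addrAC subrr add0r -{1}[N]add0n big_addn addKn.
  apply: le_trans (ler_norm_sum _ _ _) _.
  apply: le_trans (ler_sum _ (fun i _ => bx (i + N)%N)) _.
  rewrite -mulr_sumr; under eq_bigr do rewrite exprD.
  rewrite -mulr_suml expr_div_n.
  have -> : 2 * M / r ^+ N * x ^+ N = M * (2 * (x ^+ N / r ^+ N)) by ring.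
  by rewrite ler_pM2l // ler_wpM2r // divr_ge0 // exprn_ge0 // ltW.
apply: (@cvgr_to_le _ \oo%classic _ _ (fun K => `|pseries b x K - B|)).
  by apply: cvg_norm; apply: cvgB => //; exact: cvg_cst.
exists N => // k /= Nk; rewrite -(subnKC Nk); exact: tail.
Qed.

(** With [B] and [L] the truncations of the two series at order [n.+1], the polynomial [1 - B * L]
    is of order [x ^+ n.+1] near 0, so its coefficient at [n] vanishes. *)
Lemma bernoulli2_log_recurrence (R : realType) (b : nat -> R) n :
  is_bernoulli2 b ->
  \sum_(k < n.+1) (-1) ^+ k / k.+1%:R * b (n - k)%N = (n == 0%N)%:R.
Proof.
move=> [d /= d0 hb].
have hd x : 0 < x < d -> (pseries b x @ \oo --> x / ln (1 + x))%classic.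
  move=> /andP[x0 xd]; have := hb x; rewrite /= sub0r normrN (gtr0_norm x0).
  by move=> /(_ xd); rewrite /bernoulli2_gen gt_eqF.
set N := n.+1.
pose L : {poly R} := \poly_(k < N) ((-1) ^+ k / k.+1%:R).
pose B : {poly R} := \poly_(i < N) b i.
have d2 : 0 < d / 2 by rewrite divr_gt0.
(* Convergence at [d / 2] controls tails up to [d / 2 / 2], the radius used below. *)
have cvd : cvgn (pseries b (d / 2)).
  apply/cvg_ex; eexists; apply: hd; rewrite d2 /=; lra.
have [C bC] := pseries_tail_le N d2 cvd.
have [D BD] := poly_disk_bound B (d / 2 / 2).
have BL : forall i, (i < N)%N -> (1 - B * L)`_i = 0.
  apply: (@coef_eq0_horner_le _ _ _ (C + D) (d / 2 / 2)).
    by rewrite divr_gt0.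
  move=> x /andP[x0 xd].
  have lnx : 0 < ln (1 + x) by rewrite ln_gt0 // ltrDl.
  have lnx1 : ln (1 + x) / x <= 1.
    by rewrite ler_pdivrMr // mul1r; apply: le_ln1Dx; lra.
  have FB : `|x / ln (1 + x) - B.[x]| <= C * x ^+ N.
    apply: bC; first by rewrite x0.
    by apply: hd; rewrite x0; lra.
  have lL : `|ln (1 + x) / x - L.[x]| <= x ^+ N.
    have := ln1D_taylor N x0; rewrite -/L exprS.
    have -> : ln (1 + x) - x * L.[x] = x * (ln (1 + x) / x - L.[x]).
      by field; rewrite gt_eqF.
    by rewrite normrM (gtr0_norm x0) ler_pM2l.
  (* Here 1 is the product of [x / ln (1 + x)] and its inverse. The first term is bounded with
     constant [C], since [ln (1 + x) / x] is at most 1, and the second with [D]. *)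
  have -> : (1 - B * L).[x] = (x / ln (1 + x) - B.[x]) * (ln (1 + x) / x) +
      B.[x] * (ln (1 + x) / x - L.[x]).
    by rewrite hornerD hornerN hornerM hornerC; field; rewrite !gt_eqF.
  apply: le_trans (ler_normD _ _) _; rewrite [leRHS]mulrDl lerD //.
    rewrite normrM -[leRHS]mulr1 ler_pM // ger0_norm // ?divr_ge0 // ltW //.
  by rewrite normrM ler_pM // BD // gtr0_norm.
have := BL n (ltnSn n); rewrite coefB coef1 coefMr => /eqP.
rewrite subr_eq0 => /eqP ->; apply: eq_bigr => k _.
by rewrite !coef_poly ltn_ord (leq_ltn_trans (leq_subr k n)) // mulrC.
Qed.

(** * Hankel forms and determinants of Bernoulli numbers of the second kind *)

Lemma bernoulli2_hankel_psd (R : realType) (b : nat -> R) m (a : 'I_m -> nat)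
    (x : 'I_m -> R) : is_bernoulli2 b ->
  0 <= \sum_k \sum_j x k * x j *
    ((-1) ^+ (a k + a j) * (a k + a j)`!%:R * b (a k + a j).+1).
Proof.
move=> hb; have bE : b =1 @gregory R.
  apply: log_recurrence_unique => n.
  by rewrite bernoulli2_log_recurrence // gregory_recurrence.
have := integ01_rising_hankel_psd a x; congr (0 <= _).
apply: eq_bigr => k _; apply: eq_bigr => j _.
by rewrite bE gregory_integral.
Qed.

Theorem theorem1p3 (R : realType) (b : nat -> R) (hb : is_bernoulli2 b)
    (m : nat) (hm : (0 < m)%N) (a : 'I_m -> nat) :
  0 <= \det (\matrix_(k < m, j < m)
               (((a k + a j)`!)%:R * b (a k + a j).+1)) /\
  0 <= \det (\matrix_(k < m, j < m)
               ((-1) ^+ (a k + a j)%N * ((a k + a j)`!)%:R * b (a k + a j).+1)).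
Proof.
split; apply: det_ge0_quadform => x; last first.
  have := bernoulli2_hankel_psd a x hb; congr (0 <= _).
  by apply: eq_bigr => k _; apply: eq_bigr => j _; rewrite !mxE.
have := bernoulli2_hankel_psd a (fun k => (-1) ^+ a k * x k) hb.
congr (0 <= _); apply: eq_bigr => k _; apply: eq_bigr => j _.
rewrite !mxE -[RHS]mul1r -[X in _ = X * _](sqrr_sign R (a k + a j)).
by rewrite exprD; ring.
Qed.
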